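(* Let $q$ be a prime power, $t$ a positive integer, $n=2t$, $\xi\in\mathbb{F}_{q^n}\setminus\mathbb{F}_{q^t}$ and $f\in\mathcal{L}_{t,q}$. Suppose that $\langle(1,0)\rangle_{\mathbb{F}_{q^t}}\notin L_f$. Let $L=L_{\mathbb{F}_{q^t}\times S_{f,\xi}}\subseteq\mathrm{PG}(1,q^n)$. Then: (1) $L$ has rank $n$; (2) $w_L(\langle(1,0)\rangle_{\mathbb{F}_{q^n}})=w_L(\langle(0,1)\rangle_{\mathbb{F}_{q^n}})=t$; (3) for every $m\in\mathbb{F}_{q^n}^*$, writing $m=m_0+m_1\xi$ with $m_0,m_1\in\mathbb{F}_{q^t}$, we have $w_L(\langle(1,m)\rangle_{\mathbb{F}_{q^n}})=w_{L_f}(\langle(m_0,m_1)\rangle_{\mathbb{F}_{q^t}})$; (4) if $W_{L_f}(X)=\sum_{w=1}^tA_wX^w$, where $A_w$ is the number of points of weight $w$ in $L_f$, and $W_L$ is defined analogously for $L$, then $W_L(X)=2X^t+(q^t-1)W_{L_f}(X)$.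
   Context: $\mathcal{L}_{t,q}$ is the set of $\mathbb{F}_q$-linearised polynomials $\sum_{i=0}^{t-1}c_iX^{q^i}$, $c_i\in\mathbb{F}_{q^t}$, viewed as $\mathbb{F}_q$-linear maps of $\mathbb{F}_{q^t}$. For an $\mathbb{F}_q$-subspace $U$ of $\mathbb{F}_{q^N}^2$, $L_U=\{\langle u\rangle_{\mathbb{F}_{q^N}}: u\in U\setminus\{0\}\}\subseteq\mathrm{PG}(1,q^N)$, its rank is $\dim_{\mathbb{F}_q}U$, and the weight of a point $\langle v\rangle$ is $\dim_{\mathbb{F}_q}(U\cap\langle v\rangle_{\mathbb{F}_{q^N}})$ (weight 0 if the point is not in $L_U$). $L_f=L_{U_f}\subseteq\mathrm{PG}(1,q^t)$ with $U_f=\{(x,f(x)):x\in\mathbb{F}_{q^t}\}$, i.e. $L_f=\{\langle(x,f(x))\rangle_{\mathbb{F}_{q^t}}:x\in\mathbb{F}_{q^t}^*\}$. $S_{f,\xi}=\{u+\xi f(u):u\in\mathbb{F}_{q^t}\}$, and $\mathbb{F}_{q^t}\times S_{f,\xi}=\{(a,s):a\in\mathbb{F}_{q^t},s\in S_{f,\xi}\}$. *)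

(* Defs.v *)
From HB Require Import structures.
From mathcomp Require Import all_boot all_order all_algebra all_field.
From mathcomp Require Import finmap.

Set Implicit Arguments.
Unset Strict Implicit.
Unset Printing Implicit Defensive.

Import GRing.Theory.
Local Open Scope ring_scope.

(* Throughout, F is the finite field F_q (so that q = #|F|), and every
   dimension \dim is a dimension over F. *)

Section Pairing.
Variables (F : fieldType) (A B C : vectType F).
Variables (g : 'Hom(A, B)) (h : 'Hom(A, C)).

Definition pair_fun (x : A) : B * C := (g x, h x).

Fact pair_fun_is_linear : linear pair_fun.
Proof. by move=> a x y; rewrite /pair_fun !linearP. Qed.

HB.instance Definition _ :=
  GRing.isLinear.Build F A (B * C)%type *:%R pair_fun pair_fun_is_linear.

Definition pair_lfun : 'Hom(A, (B * C)%type) := linfun pair_fun.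

Lemma pair_lfunE x : pair_lfun x = (g x, h x).
Proof. by rewrite lfunE. Qed.

End Pairing.

Section ProdSpace.
Variables (F : fieldType) (B C : vectType F).

Definition prod_vs (U : {vspace B}) (V : {vspace C}) : {vspace (B * C)%type} :=
  ((linfun (@fst B C) @^-1: U) :&: (linfun (@snd B C) @^-1: V))%VS.

Lemma mem_prod_vs U V (x : B * C) :
  (x \in prod_vs U V) = (x.1 \in U) && (x.2 \in V).
Proof. by rewrite memv_cap -!memv_preim !lfunE. Qed.

End ProdSpace.

Section LinearSets.
Variables (F : finFieldType) (E : fieldExtType F).

(* For v != 0 this is the point <v>_E of PG(1, E), given as the set of the
   E-multiples of v, which is an F-subspace of E^2. *)
Definition point (v : E * E) : {vspace (E * E)%type} :=
  limg (pair_lfun (amulr v.1) (amulr v.2)).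

Lemma mem_pointP v u :
  reflect (exists a : E, u = (a * v.1, a * v.2)) (u \in point v).
Proof.
apply: (iffP memv_imgP) => [[a _ ->]|[a ->]]; exists a; rewrite ?memvf //;
  by rewrite pair_lfunE !lfunE.
Qed.

(* The type finvect_type V is V itself, with a finType structure. *)
Definition linear_set (U : {vspace (E * E)%type}) :
    {fset {vspace (E * E)%type}} :=
  [fset P in [seq point u | u : finvect_type (E * E)%type in
     [pred u | (u \in U) && (u != 0)]]]%fset.

Lemma linear_setP (U : {vspace (E * E)%type}) P :
  reflect (exists u, [/\ u \in U, u != 0 & P = point u]) (P \in linear_set U).
Proof.
rewrite in_fset; apply: (iffP imageP) => [[u /andP[Uu nzu] ->]|[u [Uu nzu ->]]].
  by exists u.
by exists u => //; apply/andP.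
Qed.

Definition weight (U P : {vspace (E * E)%type}) : nat := \dim (U :&: P).

Definition num_points (U : {vspace (E * E)%type}) (w : nat) : nat :=
  #|` [fset P in linear_set U | weight U P == w]%fset|.

(* The weight of a point is at most its own F-dimension, \dim {:E}. *)
Definition weight_poly (U : {vspace (E * E)%type}) : {poly int} :=
  \sum_(1 <= w < (\dim {:E}).+1) (num_points U w)%:R *: 'X^w.

(* f is the map defined by an element of the set L_{t,q}, for E = F_{q^t}. *)
Definition linearised (t : nat) (f : 'End(E)) : Prop :=
  exists c : 'I_t -> E,
    forall x : E, f x = (\sum_(i < t) c i *: 'X^(#|F| ^ i)).[x].

(* Every linearised polynomial does define an F-linear map. *)
Lemma linearised_lfun (t : nat) (c : 'I_t -> E) :
  exists f : 'End(E),
    forall x : E, f x = (\sum_(i < t) c i *: 'X^(#|F| ^ i)).[x].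
Proof.
have [p pr_p charFp] := finPcharP F.
have charEp : p \in [pchar E] by rewrite pchar_lalg.
have [e qE] : exists e, #|F| = (p ^ e)%N.
  by exists (logn p #|F|); exact: (card_pprimeChar charFp).
pose g x := (\sum_(i < t) c i *: 'X^(#|F| ^ i)).[x].
have gE x : g x = \sum_(i < t) c i * x ^+ (#|F| ^ i).
  by rewrite /g horner_sum; apply: eq_bigr => i _; rewrite !hornerE.
have g_lin : linear g.
  move=> a x y; rewrite !gE scaler_sumr -big_split /=; apply: eq_bigr => i _.
  rewrite exprDn_pchar; last first.
    by rewrite qE -expnM pnatX (pnatE _ pr_p) charEp.
  rewrite exprZn mulrDr -scalerAr; congr (_ *: _ + _).
  by elim: (i : nat) => // k IHk; rewrite expnSr exprM IHk expf_card.
pose gM := GRing.isLinear.Build F E E _ g g_lin.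
pose gL : {linear E -> E} := HB.pack g gM.
by exists (linfun gL) => x; rewrite lfunE.
Qed.

Definition graph (f : 'End(E)) : {vspace (E * E)%type} :=
  limg (pair_lfun \1%VF f).

Lemma mem_graph f u : (u \in graph f) = (u.2 == f u.1).
Proof.
apply/memv_imgP/eqP => [[x _ ->]|]; first by rewrite pair_lfunE id_lfunE.
by case: u => x y /= ->; exists x; rewrite ?memvf // pair_lfunE id_lfunE.
Qed.

End LinearSets.

Section Sfxi.
Variables (F : finFieldType) (E : fieldExtType F) (K : {subfield E}).

Definition Sfxi (f : 'End(subvs_of K)) (xi : E) : {vspace E} :=
  limg (linfun (@vsval F E K)
        + (amull xi \o linfun (@vsval F E K) \o f)%VF).

Lemma mem_SfxiP (f : 'End(subvs_of K)) (xi y : E) :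
  reflect (exists u, y = vsval u + xi * vsval (f u)) (y \in Sfxi f xi).
Proof.
apply: (iffP memv_imgP) => [[u _ ->]|[u ->]]; exists u; rewrite ?memvf //;
  by rewrite add_lfunE !comp_lfunE !lfunE.
Qed.

Lemma decomp_xi (xi : E) :
    (\dim {:E} = 2 * \dim K)%N -> xi \notin K ->
  forall m : E, exists m0 m1 : subvs_of K, m = vsval m0 + vsval m1 * xi.
Proof.
move=> dimE xiK m.
have tK : (0 < \dim K)%N by rewrite adim_gt0.
have Kxi : <<K; xi>>%VS = fullv.
  apply/eqP; rewrite eqEdim subvf dimE dim_Fadjoin leq_mul2r; apply/orP; right.
  by move: xiK; rewrite -adjoin_deg_eq1 /adjoin_degree; case: (_.-1).
have deg2 : adjoin_degree K xi = 2%N.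
  apply/eqP; rewrite -(eqn_pmul2r tK) -dim_Fadjoin Kxi dimE //.
have pK := Fadjoin_polyOver K xi m.
have p_i i : (Fadjoin_poly K xi m)`_i \in K by exact: (polyOverP pK).
exists (Subvs (p_i 0%N)), (Subvs (p_i 1%N)) => /=.
rewrite -[LHS](@Fadjoin_poly_eq _ _ K xi) ?Kxi ?memvf //.
have le2: (size (Fadjoin_poly K xi m) <= 2)%N by rewrite -deg2 size_Fadjoin_poly.
by rewrite (horner_coef_wide _ le2) big_ord_recl big_ord1 expr0 mulr1 expr1.
Qed.

End Sfxi.

(* Main.v *)
Require Import Defs.
From mathcomp Require Import all_boot all_order all_algebra all_field.
From mathcomp Require Import finmap.

Set Implicit Arguments.
Unset Strict Implicit.
Unset Printing Implicit Defensive.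

Import GRing.Theory.
Local Open Scope ring_scope.

(** Every point of PG(1, E) other than <(0, 1)> is <(1, m)> for a unique m, so
    counting points of weight w > 0 amounts to counting such m.  If
    m = m0 + m1 xi, then a (1, m) lies in K x S exactly when a is in K and
    a m0 + (a m1) xi = u + xi f(u) for some u in K, i.e. a (m0, m1) lies on the
    graph of f.  As f(0) = 0, the point <(0, 1)> has weight 0 for the graph, so
    m0 <> 0 whenever m <> 0 has positive weight; hence the m <> 0 of weight w
    are exactly the b + b k xi with b in K^* and <(1, k)> of weight w for the
    graph. *)

(** * Dimensions of products and of subspaces taken as spaces *)

Lemma dim_prod_vs (F : fieldType) (B C : vectType F)
    (V : {vspace B}) (W : {vspace C}) :
  \dim (prod_vs V W) = (\dim V + \dim W)%N.
Proof.
pose i1 : 'Hom(B, (B * C)%type) := pair_lfun \1%VF 0%VF.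
pose i2 : 'Hom(C, (B * C)%type) := pair_lfun 0%VF \1%VF.
have i1E x : i1 x = (x, 0) by rewrite pair_lfunE id_lfunE lfunE.
have i2E y : i2 y = (0, y) by rewrite pair_lfunE id_lfunE lfunE.
have inj1 : lker i1 == 0%VS by apply/lker0P => x y; rewrite !i1E => -[].
have inj2 : lker i2 == 0%VS by apply/lker0P => x y; rewrite !i2E => -[].
(* As a direct sum of images under two injective embeddings, the product has the sum of the two
   dimensions. *)
have ->: prod_vs V W = (i1 @: V + i2 @: W)%VS.
  apply/vspaceP => -[x y]; rewrite mem_prod_vs /=.
  apply/andP/memv_addP =>
      [[Vx Wy]|[_ /memv_imgP[v Vv ->] [_ /memv_imgP[w Ww ->]]]].
    exists (i1 x); first exact: memv_img.
    exists (i2 y); first exact: memv_img.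
    by rewrite i1E i2E; congr (_, _); rewrite /= ?addr0 ?add0r.
  by rewrite i1E i2E => -[-> ->]; rewrite addr0 add0r.
rewrite dimv_disjoint_sum.
  by rewrite !limg_dim_eq ?(eqP inj1) ?(eqP inj2) ?capv0.
apply/eqP; rewrite -subv0; apply/subvP => z.
rewrite memv_cap => /andP[/memv_imgP[v _ ->] /memv_imgP[w _]].
by rewrite i1E i2E memv0 => -[-> _].
Qed.

Lemma dim_fullv_subvs (F : fieldType) (V : vectType F) (U : {vspace V}) :
  \dim {:subvs_of U} = \dim U.
Proof. by rewrite dimvf. Qed.

(** * Points of the projective line, their weights and their number *)

Section Points.
Variables (F : finFieldType) (E : fieldExtType F).
Implicit Types (U : {vspace (E * E)%type}) (v : E * E).

Lemma mulr_pair_eq0 (a : E) v : v != 0 -> a * v.1 = 0 -> a * v.2 = 0 -> a = 0.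
Proof.
case: v => x y nzv /= /eqP; rewrite mulf_eq0 => /orP[/eqP //|/eqP x0].
move=> /eqP; rewrite mulf_eq0 => /orP[/eqP //|/eqP y0].
by rewrite x0 y0 eqxx in nzv.
Qed.

Lemma lker_mulr_pair v :
  v != 0 -> lker (pair_lfun (amulr v.1) (amulr v.2)) == 0%VS.
Proof.
move=> nzv; rewrite -subv0; apply/subvP => a.
rewrite memv_ker pair_lfunE !lfunE memv0 => /eqP[/= a1 a2].
by apply/eqP; exact: (mulr_pair_eq0 nzv).
Qed.

(** The map [a] to [a v] is an isomorphism over [F] from [E] onto the point, so a weight can be
    computed inside [E], on the scalars [a] with [a v] in [U]. *)
Lemma weightE U v : v != 0 ->
  weight U (point v) = \dim (pair_lfun (amulr v.1) (amulr v.2) @^-1: U)%VS.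
Proof.
move=> nzv; rewrite /weight /point -[X in \dim X](lpreimK (capvSr _ _)).
by rewrite lpreim_cap_limg limg_dim_eq // (eqP (lker_mulr_pair nzv)) capv0.
Qed.

Lemma weight_le_dim U v : (weight U (point v) <= \dim {:E})%N.
Proof.
apply: leq_trans (dimvS (capvSr _ _)) _.
by rewrite -(limg_ker_dim (pair_lfun (amulr v.1) (amulr v.2))) leq_addl.
Qed.

Lemma weight_gt0P U v :
  reflect (exists2 u, u \in U & u != 0 /\ u \in point v)
          (0 < weight U (point v))%N.
Proof.
rewrite lt0n dimv_eq0; apply: (iffP idP) => [nz|[u Uu [nzu uv]]].
  have := memv_pick (U :&: point v); rewrite memv_cap => /andP[uU uv].
  by exists (vpick (U :&: point v)); rewrite ?vpick0.
apply: contra nzu => /eqP z.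
have: u \in (U :&: point v)%VS by rewrite memv_cap Uu.
by rewrite z memv0.
Qed.

Lemma mem_point v : v \in point v.
Proof. by apply/mem_pointP; exists 1; rewrite !mul1r; case: v. Qed.

Lemma eq_point v u : u != 0 -> u \in point v -> point u = point v.
Proof.
move=> nzu /mem_pointP[a def_u].
have nza : a != 0 by apply: contra nzu => /eqP a0; rewrite def_u a0 !mul0r.
apply/vspaceP => z; apply/mem_pointP/mem_pointP => -[b ->].
  by exists (b * a); rewrite def_u /= !mulrA.
by exists (b / a); rewrite def_u /= !mulrA !mulfVK.
Qed.

Lemma point_normal_form v : v != 0 ->
  point v = if v.1 == 0 then point (0, 1) else point (1, v.2 / v.1).
Proof.
move=> nzv; case: eqP => [v0|/eqP v0]; apply: eq_point => //; apply/mem_pointP.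
  by exists v.2; rewrite mulr0 mulr1 -v0; case: (v).
by exists v.1; rewrite mulr1 mulrC divfK //; case: (v).
Qed.

Lemma point1_inj : injective (fun m : E => point (1, m)).
Proof.
move=> m1 m2 /= eq12; have := mem_point (1, m1); rewrite eq12 => /mem_pointP[a].
by rewrite /= mulr1 => -[<-]; rewrite mul1r.
Qed.

Lemma point1_neq01 (m : E) : point (1, m) != point (0, 1).
Proof.
apply/eqP => eq01; have := mem_point (1, m); rewrite eq01 => /mem_pointP[a].
by rewrite /= mulr0 => -[/eqP]; rewrite oner_eq0.
Qed.

Lemma pair_neq0 (a b : E) : ((a, b) != 0) = (a != 0) || (b != 0).
Proof. by rewrite -negb_and; congr (~~ _). Qed.

(** A point of positive weight automatically lies in the linear set, so one may count over the whole
    line, where <(0, 1)> and the <(1, m)> list each point once. *)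
Lemma num_pointsE U w : (0 < w)%N ->
  num_points U w = addn (weight U (point (0, 1)) == w)
    #|[pred m : finvect_type E | weight U (point (1, (m : E))) == w]|.
Proof.
move=> w0; set A := [pred m | _].
(* The boolean serves as a length: <(0, 1)> is listed once or not at all. *)
pose s := nseq (weight U (point (0, 1)) == w) (point (0, 1))
            ++ [seq point (1, (m : E)) | m : finvect_type E in A].
have uniq_s : uniq s.
  rewrite cat_uniq; apply/and3P; split; first by case: eqP.
    apply/hasPn => _ /imageP[m _ ->]; rewrite mem_nseq negb_and.
    by rewrite (point1_neq01 m) orbT.
  by rewrite map_inj_uniq ?enum_uniq // => m1 m2 /point1_inj.
transitivity #|` [fset P in s]%fset|; last first.
  by rewrite card_fseq undup_id // size_cat size_nseq size_image.
congr #|` _|; apply/fsetP => P.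
rewrite [RHS]in_fset /= in_fset /= mem_cat mem_nseq inE.
apply/andP/orP => [[/linear_setP[u [Uu nzu ->]]]|].
  rewrite (point_normal_form nzu); case: (u.1 == 0) => wP; [left | right].
    by rewrite eqxx andbT wP.
  by apply/imageP; exists (u.2 / u.1).
have in_lin v : weight U (point v) == w -> point v \in linear_set U.
  move=> /eqP wv; have /weight_gt0P[u Uu [nzu uv]]: (0 < weight U (point v))%N.
    by rewrite wv.
  by apply/linear_setP; exists u; rewrite (eq_point nzu uv).
by rewrite lt0b; case=> [/andP[w01 /eqP->]|/imageP[m wm ->]]; split=> //;
  exact: in_lin.
Qed.

(** The sum defining [weight_poly] stops at [\dim {:E}], but beyond that bound no point has weight
    [w], so one formula covers all [w > 0]. *)
Lemma coef_weight_poly U w :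
  (weight_poly U)`_w = if w == 0%N then 0 else (num_points U w)%:R.
Proof.
have num0 : (\dim {:E} < w)%N -> num_points U w = 0%N.
  move=> lt_w; rewrite num_pointsE ?(leq_ltn_trans _ lt_w) //.
  have wF v : (weight U (point v) == w) = false.
    by apply/negbTE; rewrite neq_ltn (leq_ltn_trans (weight_le_dim _ _)).
  by rewrite wF eq_card0 // => m; rewrite inE wF.
rewrite /weight_poly coef_sum.
under eq_bigr => i _ do rewrite coefZ coefXn.
case: posnP => [->|w0].
  apply: big1_seq => i; rewrite mem_index_iota => /andP[_].
  by case: i => // i; rewrite mulr0.
have [lew|ltw] := leqP w (\dim {:E}).
  rewrite (bigD1_seq w) ?iota_uniq ?mem_index_iota ?w0 //= eqxx mulr1.
  rewrite big1 ?addr0 //.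
  by move=> i /negbTE; rewrite eq_sym => ->; rewrite mulr0.
rewrite num0 //; apply: big1_seq => i.
rewrite mem_index_iota ltnS => /andP[_ /andP[_ lei]].
by rewrite gtn_eqF ?mulr0 //; exact: leq_ltn_trans lei _.
Qed.

Lemma weight_graph0 (f : 'End(E)) m : weight (graph f) (point (0, m)) = 0%N.
Proof.
apply/eqP; rewrite -leqn0 leqNgt; apply/negP => /weight_gt0P[u].
rewrite mem_graph => /eqP uf [nzu /mem_pointP[a def_u]].
by move: uf nzu; rewrite def_u /= mulr0 linear0 => ->; rewrite eqxx.
Qed.

End Points.

(** * Weights and point counts for the product of [K] and [Sfxi f xi] *)

Section DirectSum.
Variables (F : finFieldType) (E : fieldExtType F) (K : {subfield E}).
Variables (xi : E) (f : 'End(subvs_of K)).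
Hypothesis xiK : xi \notin K.
Let U := prod_vs K (Sfxi f xi).

(** If [b] were nonzero, then [xi = - a / b] would lie in [K]. *)
Lemma add_xi_eq0 (a b : subvs_of K) :
  vsval a + vsval b * xi = 0 -> a = 0 /\ b = 0.
Proof.
move=> ab0; have b0 : b = 0.
  apply: contraNeq xiK => nzb; have nzvb : vsval b != 0 by [].
  have ->: xi = - vsval a / vsval b.
    rewrite -[LHS](mulKf nzvb) -[X in _ * X](addKr (vsval a)) ab0 addr0.
    by rewrite mulrC.
  by rewrite rpred_div ?rpredN ?subvsP.
split=> //; apply: val_inj; move: ab0.
by rewrite b0 /= mul0r addr0.
Qed.

Lemma add_xi_inj (a b c d : subvs_of K) :
  vsval a + vsval b * xi = vsval c + vsval d * xi -> a = c /\ b = d.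
Proof.
move=> eq_ab; have [] := @add_xi_eq0 (a - c) (b - d).
  by rewrite !raddfB /= mulrBl addrACA eq_ab -opprD subrr.
by move=> /subr0_eq -> /subr0_eq ->.
Qed.

(** By independence of 1 and [xi] over [K], [u + xi f(u) = 0] forces [u = 0], so the map defining
    [Sfxi] is injective. *)
Lemma dim_Sfxi : \dim (Sfxi f xi) = \dim K.
Proof.
rewrite limg_dim_eq ?dim_fullv_subvs //; apply/eqP; rewrite -subv0.
apply/subvP => u; rewrite capfv memv_ker memv0 add_lfunE !comp_lfunE !lfunE /=.
by rewrite mulrC => /eqP/add_xi_eq0[-> _].
Qed.

Lemma weight_prod10 : weight U (point (1, 0)) = \dim K.
Proof.
rewrite weightE ?pair_neq0 ?oner_eq0 //; congr (\dim _); apply/vspaceP => a.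
rewrite -memv_preim pair_lfunE !lfunE /= mulr1 mulr0 mem_prod_vs /=.
by rewrite mem0v andbT.
Qed.

Lemma weight_prod01 : weight U (point (0, 1)) = \dim K.
Proof.
rewrite -dim_Sfxi weightE ?pair_neq0 ?oner_eq0 ?orbT //; congr (\dim _).
apply/vspaceP => a.
rewrite -memv_preim pair_lfunE !lfunE /= mulr1 mulr0 mem_prod_vs /=.
by rewrite mem0v.
Qed.

Lemma weight_prod1 (m0 m1 : subvs_of K) (m := vsval m0 + vsval m1 * xi) :
  m != 0 -> weight U (point (1, m)) = weight (graph f) (point (m0, m1)).
Proof.
move=> nzm; have nzm01 : (m0, m1) != 0.
  by apply: contra nzm => /eqP[m00 m10]; rewrite /m m00 m10 /= mul0r addr0.
rewrite weightE ?pair_neq0 ?oner_eq0 // weightE //.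
pose W := (pair_lfun (amulr m0) (amulr m1) @^-1: graph f)%VS.
rewrite -[X in _ = \dim X]/W.
(* The two spaces of scalars live in [E] and in [subvs_of K]; the inclusion [vsval] carries the
   second onto the first without changing its dimension. *)
have injv : lker (linfun (@vsval F E K)) == 0%VS.
  by apply/lker0P => a b; rewrite !lfunE; apply: val_inj.
rewrite -(@limg_dim_eq _ _ _ (linfun (@vsval F E K)) W) ?(eqP injv) ?capv0 //.
congr (\dim _); apply/vspaceP => a.
rewrite -memv_preim pair_lfunE !lfunE /= mulr1 mem_prod_vs /=.
have WE (b : subvs_of K) : (b \in W) = (b * m1 == f (b * m0)).
  by rewrite -memv_preim pair_lfunE !lfunE mem_graph.
apply/andP/memv_imgP => [[Ka /mem_SfxiP[u]]|[b]].
  have defa : a = vsval (Subvs Ka) by [].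
  (* Once [a] is in [K], comparing the coefficients of 1 and [xi] gives [a m0 = u] and
     [a m1 = f u]. *)
  rewrite {1}defa /m mulrDr mulrA ![xi * _]mulrC => eq_am.
  have [eq_u eq_fu] :=
    @add_xi_inj (Subvs Ka * m0) (Subvs Ka * m1) u (f u) eq_am.
  by exists (Subvs Ka); [rewrite WE eq_u eq_fu | rewrite lfunE].
rewrite WE => /eqP fb ->; rewrite lfunE /=; split; first exact: subvsP.
by apply/mem_SfxiP; exists (b * m0); rewrite -fb /= mulrDr mulrA [xi * _]mulrC.
Qed.

Hypothesis dimE : \dim {:E} = (2 * \dim K)%N.

Lemma num_points_graph w : (0 < w)%N -> num_points (graph f) w =
  #|[pred k : finvect_type (subvs_of K) |
      weight (graph f) (point (1, (k : subvs_of K))) == w]|.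
Proof. by move=> w0; rewrite num_pointsE // weight_graph0 ltn_eqF. Qed.

Lemma num_points_prod w : (0 < w)%N -> num_points U w =
  (2 * (\dim K == w) + (#|F| ^ \dim K).-1 * num_points (graph f) w)%N.
Proof.
move=> w0; rewrite num_pointsE // weight_prod01 mul2n -addnn -addnA; congr addn.
set A := [pred m : finvect_type E | _].
(* Splitting off [m = 0], that is the point <(1, 0)>, yields the second of the two extra points of
   weight [\dim K]. *)
rewrite (cardD1 0) num_points_graph //; set B := [pred k : finvect_type _ | _].
rewrite {1}/A inE weight_prod10; congr addn.
have cardK : #|finvect_type (subvs_of K)| = (#|F| ^ \dim K)%N.
  have := card_vspace (fullv : {vspace finvect_type (subvs_of K)}).
  by rewrite card_vspacef (dim_fullv_subvs K).
rewrite -cardK -(cardC1 (0 : finvect_type (subvs_of K))) -cardX.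
pose g (x : finvect_type (subvs_of K) * finvect_type (subvs_of K)) :
    finvect_type E :=
  vsval (x.1 : subvs_of K) + vsval (x.1 * x.2 : subvs_of K) * xi.
have g_inj : {in [predX predC1 0 & B] &, injective g}.
  move=> [a b] [c d] /andP[/= nza _] /andP[/= nzc _] /add_xi_inj[/= eq_ac].
  by rewrite -eq_ac => /(mulfI nza) ->.
rewrite -(card_in_image g_inj); apply: eq_card => m; rewrite !inE.
(* The coefficient pair of [m'] is [(m0, m0 k)], which spans the same point as [(1, k)]. *)
have gE (m0 k : subvs_of K) (m' := vsval m0 + vsval (m0 * k) * xi) :
    m0 != 0 ->
    m' != 0 /\ weight U (point (1, m')) = weight (graph f) (point (1, k)).
  move=> nz0; have nzm' : m' != 0.
    by apply: contra nz0 => /eqP/add_xi_eq0[->].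
  split=> //; rewrite weight_prod1 // point_normal_form ?pair_neq0 ?nz0 //=.
  by rewrite (negbTE nz0) mulrC mulKf.
apply/andP/imageP => [[nzm wm]|[[m0 k] /andP[/= nz0 wk] ->]]; last first.
  by have [nz w_eq] := gE m0 k nz0; split; rewrite // w_eq.
have [m0 [m1 def_m]] := decomp_xi dimE xiK m.
have w_eq := @weight_prod1 m0 m1; rewrite -def_m in w_eq.
have nz0 : m0 != 0.
  apply: contraTneq wm => m00.
  by rewrite w_eq // m00 weight_graph0 ltn_eqF.
have m1E : m0 * (m1 / m0) = m1 by rewrite mulrC divfK.
(* The slope [m1 / m0] is the normal form of the point <(m0, m1)>. *)
exists (m0, m1 / m0).
  apply/andP; split=> //; rewrite inE /=.
  by have [_] := gE m0 (m1 / m0) nz0; rewrite m1E -def_m => <-.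
by rewrite [LHS]def_m -[in LHS]m1E.
Qed.

End DirectSum.

Theorem theorem5p1 (q t n : nat) (F : finFieldType) (E : fieldExtType F)
    (K : {subfield E}) (xi : E) (f : 'End(subvs_of K))
    (hq : #|F| = q) (ht : (0 < t)%N) (hn : n = (2 * t)%N)
    (hE : \dim {:E} = n) (hK : \dim K = t)
    (hxi : xi \notin K) (hf : linearised t f)
    (h10 : point (1, 0) \notin linear_set (graph f)) :
  let U := prod_vs K (Sfxi f xi) in
  [/\ \dim U = n,
      weight U (point (1, 0)) = t /\ weight U (point (0, 1)) = t,
      forall (m : E) (m0 m1 : subvs_of K),
        m != 0 -> m = vsval m0 + vsval m1 * xi ->
        weight U (point (1, m)) = weight (graph f) (point (m0, m1))
    & weight_poly U
        = 2%:R *: 'X^t + ((q ^ t)%N%:R - 1) *: weight_poly (graph f)].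
Proof.
have dimE : \dim {:E} = (2 * \dim K)%N by rewrite hE hn hK.
split.
- by rewrite dim_prod_vs dim_Sfxi // hK hn mul2n addnn.
- by rewrite weight_prod10 weight_prod01.
- by move=> m m0 m1 nzm def_m; rewrite def_m weight_prod1 -?def_m.
apply/polyP => w; rewrite coefD !coefZ coefXn !coef_weight_poly.
(* The constant terms all vanish; for ['X^t] this uses [0 < t]. *)
have [->|w0] := posnP w; first by rewrite ltn_eqF // mulr0 mulr0 addr0.
rewrite num_points_prod // hK hq natrD !natrM eq_sym; congr (_ + _ * _).
(* Positivity of [q ^ t] turns the truncated predecessor into a true subtraction in the integers. *)
have Fq : (0 < #|F|)%N by apply/card_gt0P; exists 0.
by rewrite -subn1 natrB // expn_gt0 -hq Fq.
Qed.
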